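(* Let $\epsilon_0 = 0.1481$. For every $\epsilon \in [0,1]$ with $\epsilon \le \epsilon_0$, the probability of weak percolation in the Lightning Model with parameter $\epsilon$ is zero, i.e. $\mathbb{P}_\epsilon(\{0 \overset{\epsilon}{\to} \infty\}) = 0$.
   Context: Let $\overrightarrow{G}$ be the directed graph with vertex set $\mathbb{Z}^2$ and edge set $E = \{(a, a \pm e_i) : a \in \mathbb{Z}^2,\ i = 1,2\}$, where $e_1, e_2$ are the unit coordinate vectors; adjacent vertices are called neighbors. The space of vertex configurations is $\mathbb{V} = [0,1]^{\mathbb{Z}^2}$ with the product topology, its Borel $\sigma$-algebra, and Lebesgue product measure $\lambda$ (so the values $\phi_a$, $a\in\mathbb{Z}^2$, are i.i.d. uniform on $[0,1]$). The space of edge configurations is $\mathbb{E} = \{\bullet, \to\}^E$ with the product topology and Borel $\sigma$-algebra, where $\to$ means the directed edge is present (open) and $\bullet$ means it is absent. For $\epsilon \in [0,1]$ define $f_\epsilon : \mathbb{V} \to \mathbb{E}$ by: for $(a,b) \in E$, $f_\epsilon(\phi)_{(a,b)} = \;\to$ if $\phi_b < \phi_a + \epsilon$, and $\bullet$ otherwise. Let $\mathbb{P}_\epsilon = \lambda \circ f_\epsilon^{-1}$, a probability measure on $\mathbb{E}$. The Lightning Model with parameter $\epsilon$ is the probability space $\mathbb{E}$ with measure $\mathbb{P}_\epsilon$. A path from $a$ to $b$ is a finite sequence of distinct vertices $a = a_0, a_1, \dots, a_n = b$ such that each $(a_i,a_{i+1})$ is an open edge; write $a \overset{\epsilon}{\to}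 b$ if such a path exists. Weak percolation is the event $\{0 \overset{\epsilon}{\to} \infty\}$ that $\{b \in \mathbb{Z}^2 : 0 \overset{\epsilon}{\to} b\}$ is infinite, where $0$ is the origin. *)

(* Defs.v *)
From HB Require Import structures.
From mathcomp Require Import all_boot all_order all_algebra.
From mathcomp Require Import all_classical all_reals all_analysis.
Import Order.TTheory GRing.Theory Num.Theory.
Import numFieldNormedType.Exports.

Set Implicit Arguments.
Unset Strict Implicit.
Unset Printing Implicit Defensive.

Local Open Scope classical_set_scope.
Local Open Scope ring_scope.

Notation vertex := (int * int)%type.

Definition e1 : vertex := (1, 0).
Definition e2 : vertex := (0, 1).

Definition is_edge (p : vertex * vertex) : bool :=
  p.2 \in [:: p.1 + e1; p.1 - e1; p.1 + e2; p.1 - e2].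

Notation edge := {p : vertex * vertex | is_edge p}.

(* The type [0, 1] with the subspace topology.  The library requires the
   carrier of a measurable type to be pointed, hence the base point 0. *)
Definition unit_itv (R : realType) : Type := `[0%R, 1%R]%classic : set R.

HB.instance Definition _ (R : realType) := Topological.on (unit_itv R).

Lemma zero_in_unit_itv (R : realType) : (0 : R) \in `[0%R, 1%R]%classic.
Proof. by rewrite inE /= in_itv /= lexx ler01. Qed.

HB.instance Definition _ (R : realType) :=
  isPointed.Build (unit_itv R) (exist _ (0 : R) (zero_in_unit_itv R)).

Definition unit_itv_val (R : realType) (x : unit_itv R) : R := sval x.

(* The Borel sigma-algebra of the product topology on [0, 1]^(Z^2). *)
Definition vconf (R : realType) :=
  g_sigma_algebraType (@open {ptws vertex -> unit_itv R}).
HB.instance Definition _ (R : realType) := Measurable.on (vconf R).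

(* [true] stands for a present (open) edge, [false] for an absent one; bool
   carries the discrete topology. *)
Definition econf := g_sigma_algebraType (@open {ptws edge -> bool}).
HB.instance Definition _ := Measurable.on econf.

(* [lam] is Lebesgue product measure: its values on finite-dimensional cylinders
   are products of Lebesgue measures on [0, 1].  Cylinders form a pi-system
   generating the Borel sigma-algebra, so this determines [lam]. *)
Definition is_lebesgue_product (R : realType) (lam : probability (vconf R) R) :=
  forall (F : seq vertex) (B : vertex -> set (measurableTypeR R)),
    uniq F -> (forall a, a \in F -> measurable (B a)) ->
    lam [set phi | forall a, a \in F -> B a (unit_itv_val (phi a))] =
    (\prod_(a <- F) lebesgue_measure (B a `&` `[0%R, 1%R]))%E.

Definition lightning (R : realType) (eps : R) (phi : vconf R) : econf :=
  fun e => unit_itv_val (phi (sval e).2) < unit_itv_val (phi (sval e).1) + eps.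

Definition lightning_law (R : realType) (lam : probability (vconf R) R)
    (eps : R) : set econf -> \bar R :=
  pushforward lam (lightning eps).

Definition open_edge (w : econf) : rel vertex :=
  fun a b => if insub (a, b) is Some e then w e else false.

(* A path is given by its starting vertex [a] and the list [p] of the
   subsequent vertices. *)
Definition leads_to (w : econf) (a b : vertex) : Prop :=
  exists p : seq vertex,
    [/\ path (open_edge w) a p, uniq (a :: p) & last a p = b].

Definition weak_percolation : set econf :=
  [set w | infinite_set [set b | leads_to w (0, 0) b]].

(* Main.v *)
From Stdlib Require Import NArith.
Require Import Defs.
From mathcomp Require Import all_boot all_order all_algebra.
From mathcomp Require Import all_classical all_reals all_analysis.
From mathcomp Require Import measurable_realfun zify lra.
Import Order.TTheory GRing.Theory Num.Theory.
Import numFieldNormedType.Exports.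

(** The idea is to count, not all self-avoiding walks, but only those that can
be shortest open paths.

If the origin reaches infinitely many vertices, then for every [n] some vertex
is at open distance exactly [n], and a shortest open path to it has no
shortcut: when a later vertex [b] of the path is a neighbour of an earlier,
non-consecutive vertex [a], the edge from [a] to [b] is closed, so the value at
[b] is at least the value at [a] plus [eps].  The typical case is a U-turn, two
consecutive turns to the same side, after which the path is back beside the
vertex it left three steps before.  Along an open path the values rise by less than [eps] per
step, so three steps seldom gain [eps].  This makes U-turns so costly that purely
local rules (no step back, no 4-cycle, the closed chord at each U-turn) already
force the expected number of such paths to decay exponentially, for [eps] up to
4/27, which is just above 0.1481.

The values are discretised into [k = 108] bins of length 1/108, and [eps] is
raised to 16/108 = 4/27, which can only create open edges.  A shortest path
then becomes a code, a list of vertices with bins that climbs at most 16 bins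
per step and at least 15 bins between the ends of a closed chord
([percolation_sub_cylinders]).  Under the product measure each code of length
[n + 1] has probability 108^-(n + 1), because its vertices are distinct
([lam_cylinder]).  So it suffices that the number of codes is O(107^n)
([size_codes]).  This follows from a potential on codes, at least 1, whose sum
over the one-step extensions of a code is at most 107 times its value at that
code ([potential_step]).  The potential sees only the last bins and the shape
of the last three steps, and the inequality reduces to three families of
numerical inequalities for an explicit vector of 108 weights, which are checked
by computation ([weights_check_all]). *)

Set Implicit Arguments.
Unset Strict Implicit.
Unset Printing Implicit Defensive.

Local Open Scope ring_scope.

(** * Chordless codes on the square lattice *)

Definition dirs : seq vertex := [:: e1; - e1; e2; - e2].

Definition adj (a b : vertex) : bool := b - a \in dirs.

Lemma adjE (a b : vertex) : adj a b = is_edge (a, b).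
Proof.
have E (d : vertex) : (b - a == d) = (b == a + d) by rewrite subr_eq addrC.
by rewrite /adj /is_edge !inE /= !E.
Qed.

(** The discretised trace of a path: its vertices, each with the bin of its
value, the most recent one first. *)
Definition code := seq (vertex * nat).

(** The last conjunct is the closed-chord condition for shortest paths.  It
reads [q.2 + m <= p.2.+1] and not [q.2 + m <= p.2], because two values at least
[m] bin lengths apart may lie in closed bins with indices only [m - 1] apart. *)
Definition admissible (k m : nat) (h : code) (p : vertex * nat) : bool :=
  if h is (v, x) :: t then
    [&& adj v p.1, (p.2 < k)%N, (p.2 <= x + m)%N,
        p.1 \notin [seq q.1 | q <- h] &
        all (fun q => adj q.1 p.1 ==> (q.2 + m <= p.2.+1)%N) t]
  else false.

Definition extensions (k m : nat) (h : code) : seq code :=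
  if h is (v, x) :: t then
    [seq p :: h | p <- [seq (v + d, y) | d <- dirs, y <- iota 0 k]
                & admissible k m h p]
  else [::].

Fixpoint codes (k m n : nat) : seq code :=
  if n is n'.+1 then flatten [seq extensions k m h | h <- codes k m n']
  else [seq [:: (0, x)] | x <- iota 0 k].

(** After two steps in one direction and one across, in either of these orders,
a walk is not beside its starting point: the chord condition is void there. *)
Lemma dirs_double (d d' : vertex) :
  d \in dirs -> d' \in dirs -> d' != d -> d' != - d ->
  (d + d + d' \in dirs) = false /\ (d + d' + d \in dirs) = false.
Proof.
by rewrite !inE => /or4P[]/eqP-> /or4P[]/eqP->.
Qed.

Lemma dirs_fourth (d1 d2 d3 : vertex) :
  d1 \in dirs -> d2 \in dirs -> d3 \in dirs -> d2 != d1 -> d2 != - d1 ->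
  d3 != d2 -> d3 != - d2 -> d3 != d1 -> d3 = - d1.
Proof.
by rewrite !inE => /or4P[]/eqP-> /or4P[]/eqP-> /or4P[]/eqP->.
Qed.

(** If three steps of a self-avoiding walk that end with a turn lead to a
neighbour of the start, they form a U-turn.  A further turn to the same side
would close a 4-cycle. *)
Lemma dirs_uturn (d0 d1 d2 : vertex) :
  d0 \in dirs -> d1 \in dirs -> d2 \in dirs -> d1 != - d0 ->
  d2 != d1 -> d2 != - d1 -> d0 + d1 + d2 \in dirs -> d2 = - d0.
Proof.
by rewrite !inE => /or4P[]/eqP-> /or4P[]/eqP-> /or4P[]/eqP->.
Qed.

Lemma sum_dirs (F : vertex -> nat) (d r : vertex) :
  d \in dirs -> r \in dirs -> r != d -> r != - d ->
  (\sum_(d' <- dirs) F d' = F d + F (- d) + F r + F (- r))%N.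
Proof.
rewrite unlock /= !inE.
by move=> /or4P[]/eqP-> /or4P[]/eqP-> //= _ _; rewrite ?opprK; lia.
Qed.

Lemma codes_wf (k m n : nat) (h : code) : h \in codes k m n ->
  [/\ size h = n.+1, uniq [seq q.1 | q <- h], all (fun q => (q.2 < k)%N) h &
      sorted (fun p q => adj q.1 p.1) h].
Proof.
elim: n h => [|n IH] h /=.
  by case/mapP => x; rewrite mem_iota add0n => /andP[_ xk] ->; split; rewrite //= xk.
case/flattenP => s /mapP[g /IH[]].
case: g => [|[v x] g] // sg ug ag pg -> /mapP[p]; rewrite mem_filter.
case/andP => /and5P[vp pk _ np _] _ ->; split.
- by rewrite -sg.
- by rewrite map_cons cons_uniq np.
- by rewrite [all _ _]/= pk.
- by rewrite /= vp.
Qed.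

(** * A potential for counting codes *)

Section Counting.
Variables (k m t : nat) (f : nat -> nat).
Local Open Scope nat_scope.

(** The potential below bounds, up to a constant factor, the number of [n]-step
continuations of a code divided by [t ^ n], and [f x] is its profile in the last
bin [x]; the factors [t ^ 2] and [t] avoid divisions.  The coefficients 7, 5 and 6
approximate the ratios of the three types of states (last step straight on, last
step a turn, last step completing a U-turn) in the Perron vector.

[uturn_mass x1 x2] pays in advance for turning now and then once more to the
same side, from the current bin [x2] through [y] to [z]: the vertex reached is
then beside the previous one, of bin [x1], whence [x1 + m <= z.+1]. *)
Definition uturn_mass (x1 x2 : nat) : nat :=
  \sum_(y <- iota 0 k | y <= x2 + m)
    \sum_(z <- iota 0 k | (z <= y + m) && (x1 + m <= z.+1)) 6 * f z.

(** Both turns, left and right, can begin a U-turn here. *)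
Definition after_straight (x1 x2 : nat) : nat :=
  7 * t ^ 2 * f x2 + 2 * uturn_mass x1 x2.

(** Only the turn to the other side can begin a new U-turn; the turn to the same
side completes one, and the sum pays for it. *)
Definition after_turn (x0 x1 x2 : nat) : nat :=
  5 * t ^ 2 * f x2 + uturn_mass x1 x2
  + t * \sum_(y <- iota 0 k | (y <= x2 + m) && (x0 + m <= y.+1)) 6 * f y.

(** A third turn to the same side would close a 4-cycle.  The dependence on
[x1] is given up here: the coefficient 6 instead of 5 covers the largest
possible value of [uturn_mass]. *)
Definition after_uturn (x2 : nat) : nat := 6 * t ^ 2 * f x2.

Hypothesis f_gt0 : forall x, x < k -> 0 < f x.
(* The coefficients add up those of the possible next states: straight on and
   two turns, 17 = 7 + 2 * 5 and 4 = 2 + 2 * 1, in the first bound; straight on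
   and one turn, 12 = 7 + 5 and 3 = 2 + 1, in the second. *)
Hypothesis straight_bound : forall x, x < k ->
  \sum_(y <- iota 0 k | y <= x + m) (17 * t ^ 2 * f y + 4 * uturn_mass x y)
    <= 7 * t ^ 3 * f x.
Hypothesis turn_bound : forall x, x < k ->
  \sum_(y <- iota 0 k | y <= x + m) (12 * t ^ 2 * f y + 3 * uturn_mass x y)
    <= 5 * t ^ 3 * f x.
Hypothesis uturn_bound : forall x, x < k ->
  \sum_(y <- iota 0 k | y <= x + m)
    \sum_(z <- iota 0 k | z <= y + m) 6 * f z <= t ^ 2 * f x.

(** In a code, where the vertices are distinct, [adj u v] detects a U-turn. *)
Definition potential (h : code) : nat :=
  match h with
  | (v, x2) :: (v1, x1) :: (v0, x0) :: (u, _) :: _ =>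
    if (v - v1 == v1 - v0)%R then after_straight x1 x2
    else if adj u v then after_uturn x2 else after_turn x0 x1 x2
  | _ => 0
  end.

(** An upper bound for the potential after one more step [d3] into bin [y],
where [d1] and [d2] are the last two steps and [uturn] tells whether they
completed a U-turn. *)
Definition next_mass (x0 x1 x2 : nat) (uturn : bool) (d1 d2 d3 : vertex)
    (y : nat) : nat :=
  if d3 == (- d2)%R then 0
  else if d3 == d2 then after_straight x2 y
  else if (d2 == d1) || (d3 == d1) then after_turn x1 x2 y
  else if uturn then 0
  else if x0 + m <= y.+1 then after_uturn y else 0.

(** Self-avoidance excludes the step back and the closing of a 4-cycle; the chord
condition towards the vertex three steps before excludes the low bins [y] when
the step completes a U-turn. *)
Lemma potential_next (u v0 : vertex) (d1 d2 d3 : vertex) (xu x0 x1 x2 y : nat)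
    (h : code) :
  adj u v0 -> d1 \in dirs -> d2 \in dirs -> d3 \in dirs -> d2 != (- d1)%R ->
  (v0 + d1)%R != u ->
  let v1 := (v0 + d1)%R in let v := (v1 + d2)%R in
  let g := [:: (v, x2), (v1, x1), (v0, x0), (u, xu) & h] in
  admissible k m g ((v + d3)%R, y) ->
  potential (((v + d3)%R, y) :: g) <= next_mass x0 x1 x2 (adj u v) d1 d2 d3 y.
Proof.
move=> auv0 D1 D2 D3 nb1 nb0 v1 v g /and5P[_ _ _ Hn /andP[_ /andP[/implyP Hc _]]].
have Ew : (v + d3 - v = d3)%R by rewrite addrAC subrr add0r.
have Ev : (v - v1 = d2)%R by rewrite /v addrAC subrr add0r.
have Ev0 : (v + d3 - v0 = d1 + d2 + d3)%R.
  by rewrite /v /v1 -!addrA addrC !addrA subrK.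
rewrite /potential /g Ew Ev /next_mass.
have n3 : d3 != (- d2)%R.
  move: Hn; rewrite !inE => /norP[_ /norP[n1 _]].
  by apply: contra n1 => /eqP->; rewrite /= /v addrK.
rewrite (negPf n3); case: ifPn => // n32.
rewrite /adj Ev0 /= in Hc *.
have [E12 | n21] /= := eqVneq d2 d1.
  by rewrite E12 in n3 n32 *; rewrite (dirs_double D1 D3 n32 n3).1.
have [E31 | n31] /= := eqVneq d3 d1.
  by rewrite E31 (dirs_double D1 D2 n21 nb1).2.
have E3 := dirs_fourth D1 D2 D3 n21 nb1 n32 n3 n31.
have Ed : ((d1 + d2 + d3)%R \in dirs) by rewrite E3 addrAC subrr add0r.
rewrite Ed; case: ifP => [Du | _]; last by rewrite (Hc Ed).
(* A third turn to the same side returns to [u], which is already visited. *)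
exfalso; move: Hn; rewrite !inE => /norP[_ /norP[_ /norP[_ /norP[Hu _]]]].
move/eqP: Hu; apply => /=.
set d0 := (v0 - u)%R.
have D0 : d0 \in dirs by [].
have Evu : (v - u = d0 + d1 + d2)%R by rewrite /v /v1 addrAC (addrAC v0).
have n10 : d1 != (- d0)%R.
  by apply: contra nb0 => /eqP->; rewrite opprB addrC subrK.
rewrite Evu in Du; have E2 := dirs_uturn D0 D1 D2 n10 n21 nb1 Du.
by rewrite E3 /v /v1 addrAC addrK E2 opprB addrC subrK.
Qed.

(** The advance payment for the U-turn completions, summed over the first of the
two turns, is [t] times the reserve held in the previous state.  This is why
[uturn_mass] cancels in the balance of [sum_next_mass] and leaves conditions on
[f] with a single free bin. *)
Lemma sum_after_turn x1 x2 :
  \sum_(y <- iota 0 k | y <= x2 + m) after_turn x1 x2 y =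
  \sum_(y <- iota 0 k | y <= x2 + m) (5 * t ^ 2 * f y + uturn_mass x2 y)
  + t * uturn_mass x1 x2.
Proof. by rewrite big_split big_distrr. Qed.

Lemma sum_after_uturn x0 x2 :
  \sum_(y <- iota 0 k | y <= x2 + m) (if x0 + m <= y.+1 then after_uturn y else 0) =
  t ^ 2 * \sum_(y <- iota 0 k | (y <= x2 + m) && (x0 + m <= y.+1)) 6 * f y.
Proof.
rewrite -big_mkcondr big_distrr /=; apply: eq_bigr => y _.
by rewrite /after_uturn mulnCA mulnA.
Qed.

Lemma uturn_mass_le x1 x2 : x2 < k -> uturn_mass x1 x2 <= t ^ 2 * f x2.
Proof.
move=> /uturn_bound; apply: leq_trans; apply: leq_sum => y _.
by rewrite big_mkcondr; apply: leq_sum => z _; case: ifP.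
Qed.

Lemma sum_next_mass (x0 x1 x2 : nat) (uturn : bool) (d1 d2 : vertex) :
  x2 < k -> d1 \in dirs -> d2 \in dirs -> d2 != (- d1)%R ->
  \sum_(d3 <- dirs) \sum_(y <- iota 0 k | y <= x2 + m)
     next_mass x0 x1 x2 uturn d1 d2 d3 y <=
  t * (if d2 == d1 then after_straight x1 x2
       else if uturn then after_uturn x2 else after_turn x0 x1 x2).
Proof.
move=> x2k D1 D2 n21.
have nd (d : vertex) : d \in dirs -> (d == (- d)%R) = false.
  by rewrite !inE => /or4P[]/eqP->.
have opp_eq (d d' : vertex) : ((- d)%R == (- d')%R) = (d == d').
  by rewrite (inj_eq (@oppr_inj _)).
have [E21 | n12] := eqVneq d2 d1.
  (* Swapping the coordinates turns a unit vector into an orthogonal one. *)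
  have [r Dr /andP[nr nr']] :
      exists2 r : vertex, r \in dirs & (r != d2) && (r != (- d2)%R).
    exists (d2.2, d2.1); by move: D2; rewrite !inE => /or4P[]/eqP->.
  rewrite (sum_dirs _ D2 Dr nr nr') /next_mass eqxx nd // eqxx (negPf nr) (negPf nr').
  rewrite opp_eq (negPf nr) eqr_oppLR (negPf nr') E21 eqxx /=.
  rewrite [X in _ + X + _ + _]big1 // addn0 sum_after_turn.
  have := straight_bound x2k; rewrite /after_straight !big_split -!big_distrr /=.
  set S1 := \sum_(y <- _ | _) f y; set S2 := \sum_(y <- _ | _) uturn_mass _ _.
  rewrite expnS; move: (t ^ 2) => t2; nia.
have n12' : d1 != d2 by rewrite eq_sym.
have n1o : d1 != (- d2)%R by apply: contra n21 => /eqP->; rewrite opprK.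
rewrite (sum_dirs _ D2 D1 n12' n1o) /next_mass eqxx nd // eqxx (negPf n12) (negPf n12').
rewrite (negPf n1o) opp_eq (negPf n12') eqr_oppLR (negPf n1o) eqxx /=.
rewrite [(- d1)%R == _]eq_sym nd // [X in _ + X + _ + _]big1 // addn0.
rewrite sum_after_turn.
have := turn_bound x2k; rewrite /after_straight !big_split -!big_distrr /=.
set S1 := \sum_(y <- _ | _) f y; set S2 := \sum_(y <- _ | _) uturn_mass _ _.
case: uturn.
  have := uturn_mass_le x1 x2k; rewrite big1 // /after_uturn [t ^ 3]expnS.
  by move: (t ^ 2) => t2; nia.
rewrite sum_after_uturn /after_turn; set S3 := \sum_(y <- _ | _ && _) _.
rewrite [t ^ 3]expnS -[t ^ 2]/(t * t); nia.
Qed.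

Lemma sum_extensions (F : code -> nat) (v : vertex) (x : nat) (h : code) :
  \sum_(g <- extensions k m ((v, x) :: h)) F g =
  \sum_(d <- dirs) \sum_(y <- iota 0 k)
    if admissible k m ((v, x) :: h) ((v + d)%R, y)
    then F (((v + d)%R, y) :: (v, x) :: h) else 0.
Proof.
by rewrite big_map big_filter big_mkcond big_allpairs_dep.
Qed.

Lemma potential_step (n : nat) (h : code) : 2 < n -> h \in codes k m n ->
  \sum_(g <- extensions k m h) potential g <= t * potential h.
Proof.
move=> n2 /codes_wf[sh]; case: h sh => [|[v x2] [|[v1 x1] [|[v0 x0] [|[u xu] h]]]];
  move=> sh; try by move: sh n2 => /= [] // <-.
rewrite sum_extensions => /and5P[nv nv1 _ _ _] /andP[x2k _].
move=> /and4P[a2 a1 a0 _].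
have nv0 : v != v0 by move: nv; rewrite !inE !negb_or => /and4P[].
have nu : v1 != u by move: nv1; rewrite !inE !negb_or => /and3P[].
move: a2 a1; rewrite {1 2}/adj; set d2 := (v - v1)%R; set d1 := (v1 - v0)%R => D2 D1.
have E1 : v1 = (v0 + d1)%R by rewrite addrC subrK.
have E2 : v = (v0 + d1 + d2)%R by rewrite -E1 addrC subrK.
have nb : d2 != (- d1)%R.
  by apply: contra nv0 => /eqP E; rewrite E2 E addrK.
apply: leq_trans (@sum_next_mass x0 x1 x2 (adj u v) d1 d2 x2k D1 D2 nb).
rewrite big_seq [leqRHS]big_seq; apply: leq_sum => d3 D3.
rewrite [leqRHS]big_mkcond; apply: leq_sum => y _.
case: ifP => // adm.
have -> : y <= x2 + m by case/and5P: adm.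
clearbody d1 d2; subst v1 v; apply: potential_next => //.
Qed.

(** The shift by 3 is there because the shape of the last three steps is defined
only for codes with at least four vertices. *)
Lemma potential_codes (n : nat) :
  \sum_(h <- codes k m (n + 3)) potential h <=
  t ^ n * \sum_(h <- codes k m 3) potential h.
Proof.
elim: n => [|n IH]; first by rewrite mul1n.
rewrite addSn [codes _ _ _.+1]/= big_flatten big_map expnS -mulnA.
apply: leq_trans (leq_mul (leqnn t) IH); rewrite big_distrr /=.
rewrite big_seq [leqRHS]big_seq; apply: leq_sum => h Hh.
by apply: potential_step Hh; rewrite addn3.
Qed.

Lemma potential_gt0 (n : nat) (h : code) :
  0 < t -> 2 < n -> h \in codes k m n -> 0 < potential h.
Proof.
move=> t0 n2 /codes_wf[sh]; case: h sh => [|[v x2] [|[v1 x1] [|[v0 x0] [|[u xu] h]]]];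
  move=> sh; try by move: sh n2 => /= [] // <-.
move=> _ /andP[/f_gt0 f0 _] _.
rewrite /potential /after_straight /after_turn /after_uturn.
by case: ifP => _; [|case: ifP => _];
  rewrite ?addn_gt0 !muln_gt0 ?expn_gt0 ?t0 ?f0.
Qed.

Lemma size_codes_le :
  0 < t -> exists K, forall n, size (codes k m (n + 3)) <= K * t ^ n.
Proof.
move=> t0; exists (\sum_(h <- codes k m 3) potential h) => n.
rewrite mulnC; apply: leq_trans (potential_codes n).
rewrite -sum1_size big_seq [leqRHS]big_seq; apply: leq_sum => h.
by apply: potential_gt0; rewrite // addn3.
Qed.
End Counting.

(** * The numerical certificate for 108 bins *)

Section Certificate.
Local Open Scope nat_scope.

(* The sums over windows in the three bounds above are evaluated on lists of
   binary numbers, with all windows [y <= x + m] of a list handled at once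
   through its partial sums. *)
Fixpoint partial_sums (acc : N) (l : seq N) : seq N :=
  if l is a :: l' then N.add acc a :: partial_sums (N.add acc a) l' else [::].

(** For [x] close to the end the window [y <= x + m] covers the whole list; this
is the padding by the last partial sum. *)
Definition window_sums (m : nat) (l : seq N) : seq N :=
  let s := partial_sums 0 l in drop m s ++ nseq m (last 0%num s).

Fixpoint zero_prefix (n : nat) (l : seq N) : seq N :=
  match n, l with
  | n'.+1, _ :: l' => 0%num :: zero_prefix n' l'
  | _, _ => l
  end.

Definition lin_comb (a b : N) (l l' : seq N) : seq N :=
  [seq N.add (N.mul a p.1) (N.mul b p.2) | p <- zip l l'].

Definition entry (l : seq N) (x : nat) : nat := N.to_nat (nth 0%num l x).

Lemma size_partial_sums acc l : size (partial_sums acc l) = size l.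
Proof. by elim: l acc => //= a l IH acc; rewrite IH. Qed.

Lemma size_window_sums m l : m <= size l -> size (window_sums m l) = size l.
Proof.
by move=> h; rewrite /window_sums size_cat size_drop size_nseq size_partial_sums subnK.
Qed.

Lemma size_zero_prefix n l : size (zero_prefix n l) = size l.
Proof. by elim: l n => [|a l IH] [|n] //=; rewrite IH. Qed.

Lemma size_lin_comb a b l l' :
  size l = size l' -> size (lin_comb a b l l') = size l.
Proof. by move=> h; rewrite size_map size_zip h minnn. Qed.

Lemma entry_partial_sums acc l x : x < size l ->
  entry (partial_sums acc l) x
  = N.to_nat acc + \sum_(y <- iota 0 (size l) | y <= x) entry l y.
Proof.
elim: l acc x => // a l IH acc x xl.
rewrite [iota _ _]/= big_cons leq0n (iotaDl 1 0) big_map.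
case: x xl => [|x] xl.
  by rewrite big1 ?addn0 // /entry /= N2Nat.inj_add.
by rewrite {1}/entry /= -/(entry _ x) IH // N2Nat.inj_add addnA.
Qed.

Lemma entry_window_sums m l x : x < size l -> m <= size l ->
  entry (window_sums m l) x =
  \sum_(y <- iota 0 (size l) | y <= x + m) entry l y.
Proof.
move=> xl ml; rewrite /entry /window_sums nth_cat size_drop size_partial_sums.
case: ltnP => h.
  rewrite nth_drop addnC -/(entry _ _) entry_partial_sums ?add0n //; lia.
have s0 : 0 < size l by apply: leq_ltn_trans xl.
rewrite nth_nseq ifT; last by lia.
rewrite -nth_last size_partial_sums -/(entry _ _).
rewrite entry_partial_sums ?prednK // add0n big_seq_cond [RHS]big_seq_cond.
by apply: eq_bigl => y; rewrite mem_iota; lia.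
Qed.

Lemma entry_zero_prefix n l x :
  entry (zero_prefix n l) x = if x < n then 0 else entry l x.
Proof.
elim: l n x => [|a l IH] [|n] [|x] //=; first by rewrite /entry nth_nil; case: ifP.
exact: IH.
Qed.

Lemma entry_lin_comb a b l l' x : size l = size l' ->
  entry (lin_comb a b l l') x =
  N.to_nat a * entry l x + N.to_nat b * entry l' x.
Proof.
move=> h; rewrite /entry; case: (ltnP x (size l)) => xl.
  rewrite (nth_map (0%num, 0%num)) ?size_zip -?h ?minnn // nth_zip //=.
  by rewrite N2Nat.inj_add !N2Nat.inj_mul.
by rewrite !nth_default ?muln0 // ?size_lin_comb // -h.
Qed.

(** An approximate Perron vector of the transfer operator behind the potential,
scaled to maximum 1500 and rounded.  It is constant from bin 91 on, because from
there every bin is within a climb of 16. *)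
Definition weights : seq N :=
  [:: 11; 12; 14; 15; 16; 18; 19; 21; 23; 25; 27; 29; 31; 34; 36; 39; 42; 45;
      49; 52; 56; 60; 64; 68; 73; 78; 83; 89; 94; 100; 107; 113; 121; 128; 136;
      144; 153; 162; 171; 181; 192; 203; 214; 226; 239; 252; 265; 280; 295;
      310; 326; 343; 360; 379; 397; 417; 437; 458; 480; 502; 526; 549; 574;
      600; 626; 653; 680; 708; 737; 767; 797; 828; 860; 892; 925; 959; 993;
      1026; 1059; 1092; 1125; 1158; 1191; 1224; 1256; 1289; 1324; 1360; 1395;
      1430; 1465; 1500; 1500; 1500; 1500; 1500; 1500; 1500; 1500; 1500; 1500;
      1500; 1500; 1500; 1500; 1500; 1500; 1500]%num.

(** The hypotheses on [f] at bin [x], for growth rate 107: each inner sum over a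
window is one application of [window_sums], and the condition
[x + 16 <= z.+1] deletes the entries before [x + 15]. *)
Definition weights_check (x : nat) : bool :=
  let W := lin_comb 6 0 weights weights in
  let u := window_sums 16 (window_sums 16 (zero_prefix (x + 15) W)) in
  let w := nth 0%num weights x in
  [&& N.ltb 0 w,
      N.leb (nth 0%num (window_sums 16 (lin_comb (17 * (107 * 107)) 4 weights u)) x)
            (7 * (107 * (107 * 107)) * w)%num,
      N.leb (nth 0%num (window_sums 16 (lin_comb (12 * (107 * 107)) 3 weights u)) x)
            (5 * (107 * (107 * 107)) * w)%num &
      N.leb (nth 0%num (window_sums 16 (window_sums 16 W)) x) (107 * 107 * w)%num].

Lemma weights_check_all : all weights_check (iota 0 108).
Proof. vm_compute. reflexivity. Qed.

Lemma leb_nat (a b : N) : N.leb a b -> N.to_nat a <= N.to_nat b.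
Proof. by move=> /N.leb_le; lia. Qed.

Lemma entry_six_weights x :
  entry (lin_comb 6 0 weights weights) x = 6 * entry weights x.
Proof. by rewrite entry_lin_comb // [X in _ + X]mul0n addn0. Qed.

Lemma entry_uturn_mass x1 x2 : x2 < 108 ->
  entry (window_sums 16 (window_sums 16
     (zero_prefix (x1 + 15) (lin_comb 6 0 weights weights)))) x2
  = uturn_mass 108 16 (entry weights) x1 x2.
Proof.
move=> x2k.
have sz : size (zero_prefix (x1 + 15) (lin_comb 6 0 weights weights)) = 108.
  by rewrite size_zero_prefix.
rewrite entry_window_sums ?size_window_sums ?sz // /uturn_mass.
rewrite big_seq_cond [RHS]big_seq_cond; apply: eq_bigr => y.
rewrite mem_iota => /andP[/andP[_ yk] _].
rewrite entry_window_sums ?sz // big_mkcondr; apply: eq_bigr => z _.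
rewrite entry_zero_prefix entry_six_weights.
have -> : (z < x1 + 15) = ~~ (x1 + 16 <= z.+1) by lia.
by case: (x1 + 16 <= z.+1).
Qed.

(** The growth rate is a variable [t] with a known value, so that its powers are
never expanded into unary numbers. *)
Lemma weights_cert (t : nat) x : t = N.to_nat 107 -> x < 108 ->
  let f := entry weights in
  [/\ 0 < f x,
    \sum_(y <- iota 0 108 | y <= x + 16)
       (17 * t ^ 2 * f y + 4 * uturn_mass 108 16 f x y) <= 7 * t ^ 3 * f x,
    \sum_(y <- iota 0 108 | y <= x + 16)
       (12 * t ^ 2 * f y + 3 * uturn_mass 108 16 f x y) <= 5 * t ^ 3 * f x &
    \sum_(y <- iota 0 108 | y <= x + 16)
       \sum_(z <- iota 0 108 | z <= y + 16) 6 * f z <= t ^ 2 * f x].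
Proof.
move=> Et xk f; have /allP/(_ x) := weights_check_all.
rewrite mem_iota xk => /(_ isT); rewrite /weights_check.
set W := lin_comb 6 0 _ _.
have sW : size W = 108 by [].
set u := window_sums 16 (window_sums 16 (zero_prefix _ W)).
have su : size u = 108 by rewrite /u !size_window_sums ?size_zero_prefix ?sW.
have sw : size weights = 108 by [].
have win a b :
    N.to_nat (nth 0%num (window_sums 16 (lin_comb a b weights u)) x) =
    \sum_(y <- iota 0 108 | y <= x + 16)
       (N.to_nat a * f y + N.to_nat b * uturn_mass 108 16 f x y).
  rewrite -/(entry _ x) entry_window_sums ?size_lin_comb ?su //.
  rewrite big_seq_cond [RHS]big_seq_cond; apply: eq_bigr => y.
  rewrite mem_iota => /andP[/andP[_ yk] _].
  by rewrite entry_lin_comb ?su // entry_uturn_mass.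
rewrite [t ^ 3]expnS -[t ^ 2]/(t * t).
case/and4P => w0 /leb_nat cA /leb_nat cB /leb_nat cD.
rewrite win !N2Nat.inj_mul -Et -/(entry weights x) in cA.
rewrite win !N2Nat.inj_mul -Et -/(entry weights x) in cB.
rewrite !N2Nat.inj_mul -Et -/(entry _ x) -/(entry weights x) in cD.
rewrite entry_window_sums ?size_window_sums ?sW // in cD.
split.
- by rewrite /f /entry; move: w0 => /N.ltb_lt; lia.
- exact: cA.
- exact: cB.
- apply: leq_trans cD; rewrite big_seq_cond [leqRHS]big_seq_cond.
  apply: leq_sum => y; rewrite mem_iota => /andP[/andP[_ yk] _].
  rewrite entry_window_sums ?sW //; apply: leq_sum => z _.
  by rewrite entry_six_weights.
Qed.

(** Fewer than 108 continuations per step on average: this is the exponential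
gain over the probability 1/108 of each bin. *)
Lemma size_codes t : t = 107 ->
  exists K, forall n, size (codes 108 16 (n + 3)) <= K * t ^ n.
Proof.
move=> Et; have t0 : 0 < t by rewrite Et.
have {}Et : t = N.to_nat 107 by [].
have C x (xk : x < 108) := weights_cert Et xk.
by apply: (@size_codes_le 108 16 t (entry weights)) t0 => x /C[].
Qed.
End Certificate.

(** * Shortest open paths and their codes *)

(** Spheres around the origin for the distance along [r] replace an explicit
choice of shortest paths: a predecessor of a vertex on sphere [n + 1] is on
sphere [n], and every vertex of a shortest path is on the sphere of its index. *)
Section Spheres.
Local Open Scope classical_set_scope.
Variable r : rel vertex.
Hypothesis r_adj : forall a b, r a b -> adj a b.

Fixpoint steps (n : nat) : set vertex :=
  if n is n'.+1 then [set b | exists2 a, steps n' a & r a b] else [set (0, 0)].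

Definition sphere (n : nat) : set vertex :=
  [set a | steps n a /\ forall i, (i < n)%N -> ~ steps i a].

Lemma finite_steps n : finite_set (steps n).
Proof.
elim: n => [|n IH] /=; first exact: finite_set1.
apply: (@sub_finite_set _ _ (\bigcup_(a in steps n) [set` [seq a + d | d <- dirs]])).
  move=> b [a sa /r_adj rab]; exists a => //.
  have -> : b = a + (b - a) by rewrite addrC subrK.
  exact: map_f.
by apply: bigcup_finite => // a _; exact: finite_seq.
Qed.

Lemma sphere_pred n b : sphere n.+1 b -> exists2 a, sphere n a & r a b.
Proof.
move=> [[a sa rab] nb]; exists a => //; split=> // i ilt si.
by apply: (nb i.+1) => //; exists a.
Qed.

Lemma sphere_le n l b : (n <= l)%N -> sphere l b -> exists a, sphere n a.
Proof.
elim: l b => [|l IH] b; first by rewrite leqn0 => /eqP-> ?; exists b.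
rewrite leq_eqVlt => /orP[/eqP->|nl]; first by exists b.
by move=> /sphere_pred[a sa _]; exact: IH sa.
Qed.

Lemma steps_sphere l b : steps l b -> exists2 i, (i <= l)%N & sphere i b.
Proof.
elim/ltn_ind: l b => l IH b sb.
have [[i [il si]]|h] := pselect (exists i, (i < l)%N /\ steps i b).
  by have [j ji sj] := IH i il b si; exists j => //; apply: leq_trans ji (ltnW il).
by exists l => //; split=> // i il si; apply: h; exists i.
Qed.

(** An empty sphere would leave only the finitely many vertices within it. *)
Lemma sphere_neq0 :
  infinite_set (\bigcup_n steps n) -> forall n, exists a, sphere n a.
Proof.
move=> inf n; apply: contrapT => nsph; apply: inf.
apply: (@sub_finite_set _ _ (\bigcup_(i in `I_n) steps i)); last first.
  by apply: bigcup_finite => [|i _]; [exact: finite_II | exact: finite_steps].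
move=> b [l _ /steps_sphere[i _ si]]; exists i; last by case: si.
rewrite /= ltnNge; apply/negP => ni; apply: nsph; exact: sphere_le ni si.
Qed.

Variables (k m : nat) (ix : vertex -> nat).
Hypothesis ix_lt : forall a, (ix a < k)%N.
Hypothesis ix_edge : forall a b, r a b -> (ix b <= ix a + m)%N.
Hypothesis ix_nonedge : forall a b,
  adj a b -> ~~ r a b -> (ix a + m <= (ix b).+1)%N.

(** The new vertex [b] at distance [n + 1] differs from all vertices of the code,
which are closer to the origin, and an edge to [b] from any of them but the last
would bring [b] closer as well.  The last clause carries these distances through
the induction. *)
Lemma code_of_sphere n b : sphere n b ->
  exists t, [/\ (b, ix b) :: t \in codes k m n,
    {in t, forall q, q.2 = ix q.1} &
    {in t, forall q, exists2 i, (i < n)%N & steps i q.1}].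
Proof.
elim: n b => [|n IH] b.
  move=> [/= -> _]; exists [::]; split=> //.
  by apply/mapP; exists (ix (0, 0)) => //; rewrite mem_iota /= ix_lt.
move=> sb; have [a sa rab] := sphere_pred sb.
have [t [tc tix tst]] := IH a sa.
exists ((a, ix a) :: t); split.
- apply/flattenP; exists (extensions k m ((a, ix a) :: t)); first exact: map_f.
  apply/mapP; exists (b, ix b) => //; rewrite mem_filter; apply/andP; split; last first.
    apply/allpairsP; exists (b - a, ix b); split=> /=.
    + exact: r_adj.
    + by rewrite mem_iota ix_lt.
    + by rewrite addrC subrK.
  rewrite /admissible r_adj // ix_lt ix_edge //=; apply/andP; split.
    apply/negP; rewrite inE => /orP[/eqP ba|/mapP[q /tst[i ilt si] bq]].
      by case: sb => _ /(_ n (leqnn _)); apply; rewrite ba; case: sa.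
    by case: sb => _ /(_ i (ltnW ilt)); apply; rewrite bq.
  apply/allP => q qt; apply/implyP => aq; rewrite tix //; apply: ix_nonedge => //.
  apply/negP => rq; have [i ilt si] := tst q qt.
  by case: sb => _ /(_ i.+1 ilt); apply; exists q.1.
- by move=> q; rewrite inE => /orP[/eqP->|/tix].
- move=> q; rewrite inE => /orP[/eqP->|/tst[i ilt si]].
    by exists n => //; case: sa.
  by exists i => //; exact: ltnW.
Qed.
End Spheres.

(** * The probability of a code *)

Section Measure.
Local Open Scope classical_set_scope.
Variable R : realType.

Definition value (v : vertex) (phi : vconf R) : R := unit_itv_val (phi v).

Lemma value_itv v phi : 0 <= value v phi <= 1.
Proof.
rewrite /value /unit_itv_val; case: (phi v) => r /=.
by rewrite inE /= in_itv.
Qed.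

(** Coordinates are continuous for the product topology. *)
Lemma measurable_value v :
  measurable_fun setT (value v : vconf R -> measurableTypeR R).
Proof.
apply: (measurability _ (RGenOpens.measurableE R)).
move=> _ [_ [a [b ->] <-]]; rewrite setTI.
apply: sub_sigma_algebra.
have vO : open ((set_val : unit_itv R -> R) @^-1` `]a, b[%classic).
  by apply: (continuousP _).1; [exact: initial_continuous | exact: interval_open].
pose pv := @proj vertex (fun=> unit_itv R) v.
have cpv : continuous (pv : {ptws vertex -> unit_itv R} -> unit_itv R).
  exact: proj_continuous.
exact: ((continuousP _).1 cpv) vO.
Qed.

(** Closed intervals, which overlap at their ends: only their length 1/k and the
fact that they cover [0, 1] matter. *)
Definition bin (k x : nat) : set R := `[x%:R / k%:R, x.+1%:R / k%:R]%classic.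

Definition cylinder (k : nat) (h : code) : set (vconf R) :=
  [set phi | forall q, q \in h -> bin k q.2 (value q.1 phi)].

Lemma measurable_cylinder k h : measurable (cylinder k h).
Proof.
elim: h => [|q h IH].
  by rewrite (_ : cylinder k [::] = setT) //; apply/seteqP; split.
rewrite (_ : cylinder k (q :: h) = (value q.1 @^-1` bin k q.2) `&` cylinder k h).
  apply: measurableI => //; rewrite -[X in measurable X]setTI.
  by apply: measurable_value => //; exact: measurable_itv.
apply/seteqP; split => phi.
  move=> H; split; first by apply: H; rewrite inE eqxx.
  by move=> p ph; apply: H; rewrite inE ph orbT.
by move=> [H1 H2] p; rewrite inE => /orP[/eqP->|/H2].
Qed.

Lemma lebesgue_bin k x : (x < k)%N ->
  lebesgue_measure (bin k x `&` `[0%R, 1%R] : set (measurableTypeR R)) = (k%:R^-1)%:E.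
Proof.
move=> xk; have k0 : 0 < k%:R :> R by rewrite ltr0n; apply: leq_ltn_trans xk.
rewrite setIidl; last first.
  move=> r; rewrite /bin /= !in_itv /= => /andP[h1 h2]; apply/andP; split.
    by apply: le_trans h1; rewrite divr_ge0.
  by apply: le_trans h2 _; rewrite ler_pdivrMr // mul1r ler_nat.
rewrite lebesgue_measure_itv /= lte_fin ltr_pM2r ?invr_gt0 // ltr_nat ltnSn.
by rewrite -EFinB -mulrBl -natrB // subSnn mul1r.
Qed.

Variables (lam : probability (vconf R) R) (lam_prod : is_lebesgue_product lam).

(** Distinctness of the vertices is what makes the bins independent. *)
Lemma lam_cylinder k h : uniq [seq q.1 | q <- h] -> all (fun q => q.2 < k)%N h ->
  lam (cylinder k h) = ((k%:R^-1) ^+ size h)%:E.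
Proof.
move=> uh /allP hk.
(* The bin that the code prescribes at the vertex [a]. *)
pose B a : set (measurableTypeR R) :=
  bin k (nth 0%N [seq q.2 | q <- h] (index a [seq q.1 | q <- h])).
have BE q : q \in h -> B q.1 = bin k q.2.
  move=> qh; have ih : (index q h < size h)%N by rewrite index_mem.
  have Ei : index q.1 [seq q.1 | q <- h] = index q h.
    by rewrite -[X in X.1](nth_index q qh) -(nth_map q q.1) // index_uniq ?size_map.
  by rewrite /B Ei (nth_map q) // nth_index.
have -> : cylinder k h =
    [set phi | forall a, a \in [seq q.1 | q <- h] -> B a (unit_itv_val (phi a))].
  apply/seteqP; split => phi H.
    by move=> a /mapP[q qh ->]; rewrite BE //; exact: H.
  by move=> q qh; rewrite -BE //; apply: H; rewrite map_f.
rewrite lam_prod // => [|a _]; last exact: measurable_itv.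
rewrite big_map; under eq_big_seq => q qh do rewrite BE // lebesgue_bin ?hk //.
by rewrite prodEFin big_const_seq count_predT iter_mulr_1.
Qed.

Lemma lam_cylinders k n (s : seq code) :
  (forall h, h \in s -> [/\ size h = n, uniq [seq q.1 | q <- h] &
     all (fun q => q.2 < k)%N h]) ->
  let C := [set phi | exists2 h, h \in s & cylinder k h phi] in
  measurable C /\ ((lam C : \bar R) <= ((size s)%:R * (k%:R^-1) ^+ n)%:E)%E.
Proof.
elim: s => [|h s IH] H C.
  by rewrite (_ : C = set0) ?measure0 ?mul0r //; apply/seteqP; split=> // phi [].
have [mC lC] := IH (fun g gs => H g (@mem_behead _ (h :: s) g gs)).
have [sh uh ah] := H h (mem_head _ _).
have -> : C = cylinder k h `|` [set phi | exists2 h, h \in s & cylinder k h phi].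
  apply/seteqP; split=> phi /=.
    by move=> [g]; rewrite inE => /orP[/eqP->|gs] ?; [left|right; exists g].
  move=> [|[g gs]] ?; first by exists h; rewrite ?mem_head.
  by exists g => //; rewrite inE gs orbT.
have mh := measurable_cylinder k h.
split; first exact: measurableU.
apply: le_trans (measureU2 _ mh mC) _.
have lh : (lam (cylinder k h) <= (k%:R^-1 ^+ n)%:E)%E by rewrite lam_cylinder // sh.
rewrite [size _]/= -natr1 mulrDl mul1r EFinD [leRHS]addeC.
by apply: leeD; [exact: lh | exact: lC].
Qed.
End Measure.

(** * The percolation event *)

Section Event.
Local Open Scope classical_set_scope.
Variable R : realType.

Definition downhill (eps : R) (phi : vconf R) : rel vertex :=
  fun a b => adj a b && (value b phi < value a phi + eps).

Lemma open_edge_lightning (eps : R) (phi : vconf R) a b :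
  open_edge (lightning eps phi) a b = downhill eps phi a b.
Proof.
rewrite /open_edge /downhill adjE; case: insubP => [e -> Ee | /negPf-> //] /=.
by rewrite /lightning Ee.
Qed.

Lemma measurable_downhill (eps : R) a b :
  measurable [set phi : vconf R | downhill eps phi a b].
Proof.
rewrite /downhill; case: (adj a b) => /=; last first.
  by rewrite (_ : [set _ | _] = set0) //; apply/seteqP; split.
have mf : measurable_fun setT
    (fun phi : vconf R => value b phi < (value a phi + eps : measurableTypeR R)).
  apply: measurable_fun_ltr; first exact: measurable_value.
  by apply: measurable_funD; [exact: measurable_value | exact: measurable_cst].
by have := mf measurableT [set true] I; rewrite setTI.
Qed.

Lemma measurable_path (eps : R) a p :
  measurable [set phi : vconf R | path (open_edge (lightning eps phi)) a p].
Proof.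
elim: p a => [|b p IH] a /=.
  by rewrite (_ : [set _ | _] = setT) //; apply/seteqP; split.
rewrite (_ : [set _ | _] = [set phi : vconf R | downhill eps phi a b] `&`
    [set phi : vconf R | path (open_edge (lightning eps phi)) b p]); last first.
  apply/seteqP; split=> phi /=.
    by rewrite open_edge_lightning => /andP[].
  by rewrite open_edge_lightning => -[-> ->].
by apply: measurableI; [exact: measurable_downhill | exact: IH].
Qed.

(** Infinitude through an enumeration, as a countable intersection of countable
unions, for the measurability of percolation. *)
Lemma infinite_setP (T : countType) (A : set T) :
  infinite_set A <-> forall n : nat, exists2 b, A b & (n <= pickle b)%N.
Proof.
split=> [inf n | H fin].
  apply: contrapT => nex; apply: inf.
  have fin : finite_set [set b : T | pickle b \in iota 0 n].
    apply: (@finite_preimage _ _ [set i | i \in iota 0 n] pickle).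
      by move=> x y _ _; exact: (pcan_inj pickleK).
    exact: finite_seq.
  apply: sub_finite_set fin => b Ab /=; rewrite mem_iota /= add0n ltnNge.
  by apply/negP => nb; apply: nex; exists b.
have /finite_seqP[s As] := fin.
have [b Ab] := H (\max_(c <- s) pickle c).+1.
have bs : b \in s by move: Ab; rewrite As.
by apply/negP; rewrite -leqNgt; exact: leq_bigmax_seq.
Qed.

Lemma measurable_percolation (eps : R) :
  measurable ((lightning eps : vconf R -> econf) @^-1` weak_percolation).
Proof.
pose via b p := [set phi : vconf R |
  [/\ path (open_edge (lightning eps phi)) (0, 0) p, uniq ((0, 0) :: p)
    & last (0, 0) p = b]].
have mvia b p : measurable (via b p).
  have [[up lp]|h] := pselect (uniq ((0, 0) :: p) /\ last (0, 0) p = b); last first.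
    rewrite (_ : via b p = set0) //; apply/seteqP; split=> // phi [_ u l].
    by apply: h.
  rewrite (_ : via b p =
      [set phi : vconf R | path (open_edge (lightning eps phi)) (0, 0) p]).
    exact: measurable_path.
  by apply/seteqP; split=> phi; [case | move=> /= h; split].
have -> : (lightning eps : vconf R -> econf) @^-1` weak_percolation =
    \bigcap_n \bigcup_(b : vertex) \bigcup_(p : seq vertex)
      [set phi | (n <= pickle b)%N /\ via b p phi].
  apply/seteqP; split=> phi.
    move=> /infinite_setP H n _; have [b [p hp] nb] := H n.
    by exists b => //; exists p.
  move=> H; apply/infinite_setP => n.
  by have [b _ [p _ [nb hp]]] := H n I; exists b => //; exists p.
apply: bigcap_measurable => [|n _]; first by exists 0%N.
apply: countable_bigcupT_measurable => [|b]; first exact: countableP.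
apply: countable_bigcupT_measurable => [|p]; first exact: countableP.
have [nb|nb] := boolP (n <= pickle b)%N; last first.
  by rewrite (_ : [set _ | _] = set0) //; apply/seteqP; split=> // phi [].
rewrite (_ : [set _ | _] = via b p) //.
by apply/seteqP; split=> phi; [case | move=> /= h; split].
Qed.

(** Raising [eps] only adds edges, so percolation survives the passage to a
multiple of the bin length. *)
Lemma percolation_steps (eps eps' : R) (phi : vconf R) : eps <= eps' ->
  weak_percolation (lightning eps phi) ->
  infinite_set (\bigcup_n steps (downhill eps' phi) n).
Proof.
move=> le inf; apply: sub_infinite_set inf => b [p [hp _ <-]].
suff st : forall n a, steps (downhill eps' phi) n a ->
    path (open_edge (lightning eps phi)) a p ->
    steps (downhill eps' phi) (n + size p) (last a p).
  by exists (size p) => //; exact: (st 0%N).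
elim: p {hp} => [|c p IH] n a sa /=; first by rewrite addn0.
rewrite open_edge_lightning => /andP[/andP[ac lt]]; rewrite addnS -addSn; apply: IH.
exists a => //; rewrite /downhill ac; apply: lt_le_trans lt _.
by rewrite lerD2l.
Qed.

(** The minimum puts the value 1 into the last bin. *)
Definition bin_index (k : nat) (phi : vconf R) (v : vertex) : nat :=
  minn (Num.truncn (k%:R * value v phi)) k.-1.

Lemma bin_index_lt k phi v : (0 < k)%N -> (bin_index k phi v < k)%N.
Proof. by move=> k0; rewrite /bin_index gtn_min prednK // leqnn orbT. Qed.

Lemma value_bin k phi v : (0 < k)%N -> bin k (bin_index k phi v) (value v phi).
Proof.
move=> k0; have k0' : 0 < k%:R :> R by rewrite ltr0n.
have /andP[v0 v1] := value_itv v phi.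
rewrite /bin /= in_itv /= ler_pdivrMr // ler_pdivlMr // mulrC.
have /truncn_itv/andP[t1 t2] : 0 <= k%:R * value v phi by rewrite mulr_ge0.
apply/andP; split.
  by apply: le_trans t1; rewrite ler_nat geq_minl.
rewrite /bin_index; case: leqP => _; first exact: ltW.
by rewrite prednK // ler_piMr // ltW.
Qed.

Lemma bin_index_edge k m phi a b : (0 < k)%N ->
  downhill (m%:R / k%:R) phi a b -> (bin_index k phi b <= bin_index k phi a + m)%N.
Proof.
move=> k0 /andP[_ lt]; have k0' : 0 < k%:R :> R by rewrite ltr0n.
have := value_bin phi a k0; have := value_bin phi b k0.
rewrite /bin /= !in_itv /= => /andP[b1 _] /andP[_ a2].
move: lt; rewrite ler_pdivrMr // ler_pdivlMr // in a2 b1 *.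
move=> lt; rewrite -ltnS -(ltr_nat R) -addSn natrD.
apply: le_lt_trans b1 _; rewrite -ltr_pdivlMr // mulrDl; apply: lt_le_trans lt _.
by rewrite lerD2r ler_pdivlMr.
Qed.

Lemma bin_index_nonedge k m phi a b : (0 < k)%N -> adj a b ->
  ~~ downhill (m%:R / k%:R) phi a b ->
  (bin_index k phi a + m <= (bin_index k phi b).+1)%N.
Proof.
move=> k0 ab; rewrite /downhill ab /= -leNgt => le.
have k0' : 0 < k%:R :> R by rewrite ltr0n.
have := value_bin phi a k0; have := value_bin phi b k0.
rewrite /bin /= !in_itv /= => /andP[_ b2] /andP[a1 _].
rewrite -(ler_nat R) natrD -(ler_pM2r (_ : 0 < k%:R^-1 :> R)) ?invr_gt0 // mulrDl.
by apply: le_trans b2; apply: le_trans le; rewrite lerD2r.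
Qed.
End Event.

(** * Decay of the percolation probability *)

Lemma percolation_sub_cylinders (R : realType) (eps : R) (k m n : nat) :
  (0 < k)%N -> eps <= m%:R / k%:R ->
  ((lightning eps : vconf R -> econf) @^-1` weak_percolation `<=`
   [set phi | exists2 h, h \in codes k m n & cylinder k h phi])%classic.
Proof.
move=> k0 le phi perc.
have radj a b : downhill (m%:R / k%:R) phi a b -> adj a b by case/andP.
have inf := percolation_steps le perc.
have [b sb] := sphere_neq0 radj inf n.
have [t [tc tix _]] := code_of_sphere radj (fun a => bin_index_lt phi a k0)
  (fun a b => @bin_index_edge R k m phi a b k0)
  (fun a b => @bin_index_nonedge R k m phi a b k0) sb.
exists ((b, bin_index k phi b) :: t) => // q.
rewrite inE => /orP[/eqP->|/tix ->]; exact: value_bin.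
Qed.

Lemma lam_percolation_le (R : realType) (lam : probability (vconf R) R)
    (eps : R) (k m n : nat) :
  is_lebesgue_product lam -> (0 < k)%N -> eps <= m%:R / k%:R ->
  (lam ((lightning eps : vconf R -> econf) @^-1` weak_percolation)%classic
   <= ((size (codes k m n))%:R * k%:R^-1 ^+ n.+1)%:E)%E.
Proof.
move=> lam_prod k0 le.
have [mC lC] := @lam_cylinders R lam lam_prod k n.+1 (codes k m n)
  (fun h hc => let: And4 sh uh ah _ := codes_wf hc in And3 sh uh ah).
apply: le_trans lC; apply: le_measure; rewrite ?inE //.
  exact: measurable_percolation.
exact: percolation_sub_cylinders.
Qed.

Theorem theorem3p1 (R : realType) (lam : probability (vconf R) R)
    (lam_prod : is_lebesgue_product lam) (eps : R)
    (eps_ge0 : 0 <= eps) (eps_le1 : eps <= 1)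
    (eps_le : eps <= 1481 / 10 ^+ 4) :
  lightning_law lam eps weak_percolation = 0%E.
Proof.
rewrite /lightning_law /pushforward.
set E := (_ @^-1` _)%classic.
(* 16/108 = 4/27 = 0.148148... *)
have le : eps <= 16%:R / 108%:R by apply: le_trans eps_le _; lra.
have [t Et] : exists t, t = 107%N by exists 107%N.
have [K sizeK] := size_codes Et.
pose q : R := t%:R / 108%:R.
have bound n : (lam E <= (geometric K%:R q n)%:E)%E.
  apply: le_trans (lam_percolation_le (n + 3) lam_prod (isT : 0 < 108)%N le) _.
  rewrite lee_fin /geometric /= -addnS exprD mulrA.
  apply: (@le_trans _ _ ((size (codes 108 16 (n + 3)))%:R * 108%:R^-1 ^+ n)).
    by rewrite ler_piMr ?mulr_ge0 // exprn_ile1 // invf_le1 // ler1n.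
  rewrite /q exprMn mulrA ler_wpM2r ?exprn_ge0 //.
  by rewrite -natrX -natrM ler_nat.
have fE : lam E \is a fin_num.
  by apply: fin_num_measure; exact: measurable_percolation.
apply/eqP; rewrite eq_le measure_ge0 andbT -(fineK fE) lee_fin.
have q1 : `|q| < 1.
  by rewrite /q ger0_norm ?divr_ge0 // Et ltr_pdivrMr // mul1r ltr_nat.
have cq := cvg_geometric K%:R q1.
rewrite -(cvg_lim (@Rhausdorff R) cq); apply: limr_ge.
  by apply/cvg_ex; exists 0.
by apply: nearW => n; rewrite -lee_fin fineK.
Qed.
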